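(* For a positive integer $n$, let $\mathcal{A}_n=\{(x,y)\in\mathbb{Z}^2: 1\le x,y\le n\}$. A closed broken line supported on $\mathcal{A}_n$ is a cyclic ordering $L=(a_1,a_2,\ldots,a_{n^2})$ of all $n^2$ points of $\mathcal{A}_n$ (each point used exactly once), with $a_{n^2+1}=a_1$, whose edges $[a_i,a_{i+1}]$, $1\le i\le n^2$, are non-self-intersecting: two distinct edges meet only if they are consecutive, and then only at their shared endpoint. Straight angles are allowed, i.e. three consecutive vertices may be collinear. Define $s(L)=\sum_{i=1}^{n^2}|a_{i+1}-a_i|^2$, where $|\cdot|$ is the Euclidean norm, and let $a(n)$ be the maximum of $s(L)$ over all such $L$. Define $\alpha(n)=\frac{8}{27}n^4-\frac{464}{729}n^3+r(n)$, where $r(n)$ is determined by the residue of $n$ modulo $9$: - if $n\equiv 0 \pmod 9$: $r(n)=-\frac{4}{3}n^2+6n-2$; - if $n\equiv 1 \pmod 9$: $r(n)=-\frac{292}{243}n^2+\frac{922}{243}n-\frac{1642}{729}$; - if $n\equiv 2 \pmod 9$: $r(n)=-\frac{308}{243}n^2+\frac{946}{243}n-\frac{1724}{729}$; - if $n\equiv 3 \pmod 9$: $r(n)=-\frac{4}{3}n^2+\frac{158}{27}n-\frac{64}{27}$; - if $n\equiv 4 \pmod 9$: $r(n)=-\frac{292}{243}n^2+\frac{886}{243}n-\frac{1804}{729}$; - if $n\equiv 5 \pmod 9$: $r(n)=-\frac{308}{243}n^2+\frac{874}{243}n-\frac{1400}{729}$; - if $n\equiv 6 \pmod 9$: $r(n)=-\frac{4}{3}n^2+\frac{158}{27}n-\frac{44}{27}$;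 - if $n\equiv 7 \pmod 9$: $r(n)=-\frac{292}{243}n^2+\frac{886}{243}n-\frac{1264}{729}$; - if $n\equiv 8 \pmod 9$: $r(n)=-\frac{308}{243}n^2+\frac{946}{243}n-\frac{1292}{729}$. Then for every integer $n\ge 9$, $a(n)\ge \alpha(n)$.
   Context: Edges are closed straight segments in $\mathbb{R}^2$ between the listed lattice points. The broken line need not be convex. *)

(* Defs.v *)
From HB Require Import structures.
From mathcomp Require Import all_boot all_order all_algebra.
From mathcomp Require Import all_classical all_reals.

Set Implicit Arguments.
Unset Strict Implicit.
Unset Printing Implicit Defensive.

Import Order.TTheory GRing.Theory Num.Theory.
Local Open Scope classical_set_scope.
Local Open Scope ring_scope.

(* Ordinals start at 0, so the grid {1, ..., n}^2 is encoded as 'I_n * 'I_n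
   by shifting both coordinates by 1. *)
Definition lattice_point (R : realType) (n : nat) (a : 'I_n * 'I_n) : R * R :=
  (a.1.+1%:R, a.2.+1%:R).

Definition segment (R : realType) (a b : R * R) : set (R * R) :=
  [set p | exists2 t : R, 0 <= t <= 1 &
    p = ((1 - t) * a.1 + t * b.1, (1 - t) * a.2 + t * b.2)].

(* The norm of the library on R * R is the max norm, hence this explicit
   squared Euclidean distance. *)
Definition sqdist (R : realType) (a b : R * R) : R :=
  (b.1 - a.1) ^+ 2 + (b.2 - a.2) ^+ 2.

Section BrokenLine.
Variables (R : realType) (n : nat).
Implicit Type L : {ffun 'I_(n ^ 2) -> 'I_n * 'I_n}.

Definition vertex L (i : 'I_(n ^ 2)) : R * R := lattice_point R (L i).

(* [ordS] is the cyclic successor, so the last edge returns to the start. *)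
Definition edge L (i : 'I_(n ^ 2)) : set (R * R) :=
  segment (vertex L i) (vertex L (ordS i)).

Definition non_self_intersecting L : Prop :=
  forall (i j : 'I_(n ^ 2)) (p : R * R), i != j ->
    edge L i p -> edge L j p ->
    (j = ordS i /\ p = vertex L j) \/ (i = ordS j /\ p = vertex L i).

Definition closed_broken_line L : Prop :=
  bijective L /\ non_self_intersecting L.

Definition sum_sq L : R :=
  \sum_(i < n ^ 2) sqdist (vertex L i) (vertex L (ordS i)).

(* [sum_sq] is nonnegative, so the neutral element 0 does not affect the
   maximum as soon as there is a closed broken line. *)
Definition max_sum_sq : R :=
  \big[Num.max/0]_(L : {ffun 'I_(n ^ 2) -> 'I_n * 'I_n}
                     | `[< closed_broken_line L >]) sum_sq L.

Definition remainder_term : R :=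
  let x : R := n%:R in
  match (n %% 9)%N with
  | 0%N => - (4 / 3) * x ^+ 2 + 6 * x - 2
  | 1%N => - (292 / 243) * x ^+ 2 + 922 / 243 * x - 1642 / 729
  | 2%N => - (308 / 243) * x ^+ 2 + 946 / 243 * x - 1724 / 729
  | 3%N => - (4 / 3) * x ^+ 2 + 158 / 27 * x - 64 / 27
  | 4%N => - (292 / 243) * x ^+ 2 + 886 / 243 * x - 1804 / 729
  | 5%N => - (308 / 243) * x ^+ 2 + 874 / 243 * x - 1400 / 729
  | 6%N => - (4 / 3) * x ^+ 2 + 158 / 27 * x - 44 / 27
  | 7%N => - (292 / 243) * x ^+ 2 + 886 / 243 * x - 1264 / 729
  | _ => - (308 / 243) * x ^+ 2 + 946 / 243 * x - 1292 / 729
  end.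

Definition alpha : R :=
  8 / 27 * n%:R ^+ 4 - 464 / 729 * n%:R ^+ 3 + remainder_term.

End BrokenLine.

(* Main.v *)
Require Import Defs.
From mathcomp Require Import all_boot all_order all_algebra.
From mathcomp Require Import all_classical all_reals.
From mathcomp Require Import zify ring lra.

(** The bound is attained by an explicit polygon. On a line x - y = c carrying
    N points of the grid, the first third of the points is joined to the last
    third of the points of the line x - y = c + 1 by a zigzag of 2N/3 edges of
    length about 2/3 of that of the line, and the middle third is traversed in
    unit diagonal steps; this produces one path through all these lines, from
    the top left corner to the bottom right one. The path is closed up along
    the right and top sides of the square. To compensate for the short edges
    there, the right side takes over J (about n/3) points at the bottom of the
    next to last column, where the lines are short anyway, and zigzags between
    them and the upper third of the last column; the top side symmetrically
    takes over K points at the left of the next to last row.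

    Each edge joins lattice points on the same line or on consecutive lines of
    one of the families x - y = c, x = c, y = c, so that two edges of one family
    can only meet at lattice points, while edges of different families are
    weakly separated by one of the lines x = n - 2, y = n - 2, x = y (with
    coordinates 0, ..., n - 1). *)

Set Implicit Arguments.
Unset Strict Implicit.
Unset Printing Implicit Defensive.

Import Order.TTheory GRing.Theory Num.Theory.
Local Open Scope ring_scope.

(** * Intersection of lattice segments *)

Section Segments.
Variable R : realFieldType.
Implicit Types (s t : R) (f h : int).

Lemma int_param_endpoint t (z : int) :
  0 <= t <= 1 -> t = z%:~R -> t = 0 \/ t = 1.
Proof.
move=> /andP[t0 t1] tz; move: t0 t1; rewrite tz ler0z lerz1 => z0 z1.
have [->|->] : z = 0 \/ z = 1 by lia.
  by left.
by right.
Qed.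

(** Here [f] numbers the parallel lines of a family and [h] is an integer coordinate along them; in
    both cases no lattice point lies inside the edge. *)
Definition thin (fa ha fb hb : int) :=
  fb = fa + 1 \/ fb = fa /\ hb = ha + 1.

(** The second edge has constant integer [f], which forces [s] to be an integer, so the common point
    is an end of the first edge. Its [h] is then an integer, which forces the same for [t]. *)
Lemma thin_strip_unit fa ha fb hb fa' ha' fb' hb' s t :
  0 <= s <= 1 -> 0 <= t <= 1 ->
  fb = fa + 1 -> fb' = fa' /\ hb' = ha' + 1 ->
  (1 - s) * fa%:~R + s * fb%:~R = (1 - t) * fa'%:~R + t * fb'%:~R ->
  (1 - s) * ha%:~R + s * hb%:~R = (1 - t) * ha'%:~R + t * hb'%:~R ->
  (s = 0 \/ s = 1) /\ (t = 0 \/ t = 1).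
Proof.
move=> s01 t01 -> [-> ->]; rewrite !intrD => ef eh.
have sE : s = (fa' - fa)%:~R by rewrite intrB; lra.
have s_end := int_param_endpoint s01 sE; split=> //.
case: s_end eh => -> eh.
  by apply: (@int_param_endpoint _ (ha - ha')) => //; rewrite intrB; lra.
by apply: (@int_param_endpoint _ (hb - ha')) => //; rewrite intrB; lra.
Qed.

(** Edges in different strips share at most a bounding line. In a common strip [s = t], and the
    difference of the [h] values is affine in [s]; the monotonicity hypothesis keeps its sign, so
    for distinct starting points it can vanish only at [s = 1]. *)
Lemma thin_edges_meet fa ha fb hb fa' ha' fb' hb' s t :
  0 <= s <= 1 -> 0 <= t <= 1 ->
  thin fa ha fb hb -> thin fa' ha' fb' hb' ->
  (fa = fa' -> fb = fa + 1 -> fb' = fa + 1 ->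
     (ha < ha' -> hb <= hb') /\ (ha' < ha -> hb' <= hb)) ->
  (1 - s) * fa%:~R + s * fb%:~R = (1 - t) * fa'%:~R + t * fb'%:~R ->
  (1 - s) * ha%:~R + s * hb%:~R = (1 - t) * ha'%:~R + t * hb'%:~R ->
  (s = 0 \/ s = 1) /\ (t = 0 \/ t = 1) \/
  [/\ fa = fa', ha = ha', fb = fb' & hb = hb'].
Proof.
move=> s01 t01 [fbE|ufb] [fbE'|ufb'] mono ef eh; last 1 first.
- case: ufb ufb' ef eh => -> -> [-> ->]; rewrite !intrD => ef eh.
  have faE : fa = fa' by apply/eqP; rewrite -(eqr_int R); apply/eqP; lra.
  have [e|[lt|lt]] : ha = ha' \/ (ha + 1 <= ha' \/ ha' + 1 <= ha) by lia.
  + by right; rewrite faE e.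
  + have : (ha + 1)%:~R <= ha'%:~R :> R by rewrite ler_int.
    rewrite intrD => le; left; split; [right|left]; lra.
  + have : (ha' + 1)%:~R <= ha%:~R :> R by rewrite ler_int.
    rewrite intrD => le; left; split; [left|right]; lra.
- have [e|[lt|lt]] : fa = fa' \/ (fa + 1 <= fa' \/ fa' + 1 <= fa) by lia.
  + have st : s = t by move: ef; rewrite fbE fbE' -e !intrD; lra.
    subst t; case: (mono e fbE (etrans fbE' (congr1 (+%R^~ 1) (esym e)))) => m1 m2.
    have [eqh|[lt|lt]] : ha = ha' \/ (ha + 1 <= ha' \/ ha' + 1 <= ha) by lia.
    * case: (eqVneq hb hb') => [eqb|neb]; first by right; split => //; lia.
      left; have s0 : s = 0; last by split; left.
      have := eh; rewrite eqh => eh'.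
      have /eqP : s * (hb%:~R - hb'%:~R) = 0 by lra.
      by rewrite mulf_eq0 subr_eq0 eqr_int (negPf neb) orbF => /eqP.
    * have hbl : hb%:~R <= hb'%:~R :> R by rewrite ler_int m1 //; lia.
      have : (ha + 1)%:~R <= ha'%:~R :> R by rewrite ler_int.
      rewrite intrD => le; left; have s1 : s = 1 by nra.
      by split; right.
    * have hbl : hb'%:~R <= hb%:~R :> R by rewrite ler_int m2 //; lia.
      have : (ha' + 1)%:~R <= ha%:~R :> R by rewrite ler_int.
      rewrite intrD => le; left; have s1 : s = 1 by nra.
      by split; right.
  + have : (fa + 1)%:~R <= fa'%:~R :> R by rewrite ler_int.
    move: ef; rewrite fbE fbE' !intrD => ef le.
    by left; split; [right|left]; lra.
  + have : (fa' + 1)%:~R <= fa%:~R :> R by rewrite ler_int.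
    move: ef; rewrite fbE fbE' !intrD => ef le.
    by left; split; [left|right]; lra.
- by left; apply: (thin_strip_unit s01 t01 fbE ufb' ef eh).
- by left; have [] := thin_strip_unit t01 s01 fbE' ufb (esym ef) (esym eh).
Qed.

(** The common point must satisfy f = k. A convex combination of two nonnegative numbers, not both
    zero, vanishes only at an end of the parameter interval. *)
Lemma separated_edges_meet (k fa fb fa' fb' : int) s t :
  0 <= s <= 1 -> 0 <= t <= 1 ->
  k <= fa -> k <= fb -> (fa != k) || (fb != k) ->
  fa' <= k -> fb' <= k -> (fa' != k) || (fb' != k) ->
  (1 - s) * fa%:~R + s * fb%:~R = (1 - t) * fa'%:~R + t * fb'%:~R ->
  (s = 0 \/ s = 1) /\ (t = 0 \/ t = 1).
Proof.
have key (x y : int) (u : R) : 0 <= u <= 1 -> 0 <= x -> 0 <= y -> (x != 0) || (y != 0) ->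
    (1 - u) * x%:~R + u * y%:~R <= 0 :> R -> u = 0 \/ u = 1.
  move=> u01 x0 y0 xy le0.
  have X0 : 0 <= x%:~R :> R by rewrite ler0z.
  have Y0 : 0 <= y%:~R :> R by rewrite ler0z.
  have e1 : (1 - u) * x%:~R = 0 by nra.
  have e2 : u * y%:~R = 0 by nra.
  move/eqP: e1; rewrite mulf_eq0 => /orP[|]; first by right; lra.
  rewrite intr_eq0 => /eqP x00; move/eqP: e2; rewrite mulf_eq0 => /orP[|].
    by left; lra.
  by rewrite intr_eq0 => /eqP y00; move: xy; rewrite x00 y00.
move=> s01 t01 ka kb ab ka' kb' ab' e.
have ra : 0 <= (fa - k)%:~R :> R by rewrite ler0z; lia.
have rb : 0 <= (fb - k)%:~R :> R by rewrite ler0z; lia.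
have ra' : 0 <= (k - fa')%:~R :> R by rewrite ler0z; lia.
have rb' : 0 <= (k - fb')%:~R :> R by rewrite ler0z; lia.
split.
  by apply: (@key (fa - k) (fb - k)) => //; try lia; move: ra rb ra' rb'; rewrite !intrB; nra.
by apply: (@key (k - fa') (k - fb')) => //; try lia; move: ra rb ra' rb'; rewrite !intrB; nra.
Qed.
End Segments.

(** * The edges of the polygon *)

Definition swap (a : nat * nat) := (a.2, a.1).

Section Edges.
Variables (m J K : nat) (d : nat -> nat).
Implicit Types a b c e : nat * nat.
Local Open Scope nat_scope.

(** The index k of the diagonal x - y = k - m; adding [m] first makes the subtraction exact on the
    core. *)
Definition level a := a.1 + m - a.2.

Definition in_core a := (a.1 <= m) && (a.2 <= m).

(* The last two conditions keep the edge off the lines x = m and y = m, which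
   separate the core from the two sides. *)
Definition strip_edge a b :=
  [&& in_core a, in_core b, level b == (level a).+1,
      (b.1 == a.1 + d (level a)) || (b.1 == (a.1 + d (level a)).+1),
      (a.1 < m) || (b.1 < m) & (a.2 < m) || (b.2 < m)].

Definition diagonal_edge a b :=
  [&& in_core a, in_core b, b.1 == a.1.+1 & b.2 == a.2.+1].

Definition core_edge a b := strip_edge a b || diagonal_edge a b.

(* Stated for the right side; the top side is its image under [swap]. *)
Definition side_edge J a b :=
  [&& a.1 == m, b.1 == m.+1 &
      (a.2 == 0) && (b.2 == 0) ||
      [&& 0 < a.2, b.2 <= m.+1 &
          (b.2 == a.2 + (m - J)) || (b.2 == (a.2 + (m - J)).+1)]]
  || [&& a.1 == m.+1, b.1 == m.+1, b.2 == a.2.+1 & b.2 <= m.+1].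

Definition oriented_edge a b :=
  [|| core_edge a b, side_edge J a b | side_edge K (swap a) (swap b)].

(** Oriented edges suit the intersection lemmas, but a zigzag crosses its strip alternately in both
    directions. *)
Definition tour_edge a b := oriented_edge a b || oriented_edge b a.
End Edges.

(** * Pairwise intersections of the edges of the polygon *)

Section Meeting.
Variables (R : realFieldType) (m J K : nat) (d : nat -> nat).
Hypotheses (Jm : (J.+2 <= m)%N) (Km : (K.+2 <= m)%N).
Implicit Types a b c e : nat * nat.

Definition cross_at (s t : R) a b c e :=
  (1 - s) * a.1%:R + s * b.1%:R = (1 - t) * c.1%:R + t * e.1%:R /\
  (1 - s) * a.2%:R + s * b.2%:R = (1 - t) * c.2%:R + t * e.2%:R.

Definition proper_meet (s t : R) a b c e :=
  (s = 0 \/ s = 1) /\ (t = 0 \/ t = 1) \/ a = c /\ b = e.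

Lemma cross_at_swap s t a b c e :
  cross_at s t a b c e -> cross_at s t (swap a) (swap b) (swap c) (swap e).
Proof. by case. Qed.

Lemma cross_at_sym s t a b c e : cross_at s t a b c e -> cross_at t s c e a b.
Proof. by case. Qed.

Lemma proper_meet_sym s t a b c e :
  proper_meet s t a b c e -> proper_meet t s c e a b.
Proof. by case=> [[]|[]]; [left|right]. Qed.

(** Take f = x - y and h = x. All edges of a strip increase x by D or D + 1 with the same D, so the
    order of the starting points is weakly kept at the ends. *)
Lemma core_edges_meet s t a b c e : 0 <= s <= 1 -> 0 <= t <= 1 ->
  core_edge m d a b -> core_edge m d c e -> cross_at s t a b c e ->
  proper_meet s t a b c e.
Proof.
move=> s01 t01 ab ce [e1 e2].
have tab : thin (a.1%:Z - a.2%:Z) a.1%:Z (b.1%:Z - b.2%:Z) b.1%:Z.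
  move: ab; rewrite /thin /core_edge /strip_edge /diagonal_edge /level /in_core.
  lia.
have tce : thin (c.1%:Z - c.2%:Z) c.1%:Z (e.1%:Z - e.2%:Z) e.1%:Z.
  move: ce; rewrite /thin /core_edge /strip_edge /diagonal_edge /level /in_core.
  lia.
case: (thin_edges_meet s01 t01 tab tce _ _ e1).
- move=> l1 l2 l3.
  have dE : d (level m a) = d (level m c).
    congr d; move: ab ce.
    rewrite /core_edge /strip_edge /diagonal_edge /level /in_core; lia.
  move: ab ce; rewrite /core_edge /strip_edge dE /diagonal_edge /level /in_core.
  by move: (d _) => D; lia.
- by rewrite !intrB; lra.
- by left.
- case: a b c e {ab ce e1 e2 tab tce} => [a1 a2] [b1 b2] [c1 c2] [x1 x2] /=.
  by case=> *; right; split; congr pair; lia.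
Qed.

(** Take f = x and h = y. The zigzag edges raise y by m - I or m - I + 1, and the bottom edge starts
    below all of them. *)
Lemma side_edges_meet I s t a b c e : 0 <= s <= 1 -> 0 <= t <= 1 ->
  side_edge m I a b -> side_edge m I c e -> cross_at s t a b c e ->
  proper_meet s t a b c e.
Proof.
move=> s01 t01 ab ce [e1 e2].
have tab : thin a.1 a.2 b.1 b.2.
  by move: ab; rewrite /thin /side_edge; lia.
have tce : thin c.1 c.2 e.1 e.2.
  by move: ce; rewrite /thin /side_edge; lia.
case: (thin_edges_meet s01 t01 tab tce _ e1 e2).
- by move=> l1 l2 l3; move: ab ce; rewrite /side_edge; lia.
- by left.
- case: a b c e {ab ce e1 e2 tab tce} => [a1 a2] [b1 b2] [c1 c2] [x1 x2] /=.
  by case=> *; right; split; congr pair; lia.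
Qed.

Lemma core_side_meet I s t a b c e : 0 <= s <= 1 -> 0 <= t <= 1 ->
  (a.1 <= m)%N -> (b.1 <= m)%N -> (a.1 < m)%N || (b.1 < m)%N ->
  side_edge m I c e -> cross_at s t a b c e -> proper_meet s t a b c e.
Proof.
move=> s01 t01 am bm abm ce [e1 _]; left.
suff [] : (t = 0 \/ t = 1) /\ (s = 0 \/ s = 1) by [].
by apply: (separated_edges_meet (k := m%:Z) (fa := c.1%:Z) (fb := e.1%:Z)
  (fa' := a.1%:Z) (fb' := b.1%:Z) t01 s01 _ _ _ _ _ _ (esym e1));
  move: ce; rewrite /side_edge; lia.
Qed.

(** The line x = y separates the two sides; [Jm] and [Km] put the zigzag ends in column m and row m
    strictly off it. *)
Lemma side_top_meet s t a b c e : 0 <= s <= 1 -> 0 <= t <= 1 ->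
  side_edge m J a b -> side_edge m K (swap c) (swap e) ->
  cross_at s t a b c e -> proper_meet s t a b c e.
Proof.
move=> s01 t01 ab ce [e1 e2]; left.
by apply: (separated_edges_meet (k := 0) (fa := a.1%:Z - a.2%:Z)
  (fb := b.1%:Z - b.2%:Z) (fa' := c.1%:Z - c.2%:Z) (fb' := e.1%:Z - e.2%:Z)
  s01 t01); rewrite ?intrB;
  try (by move: ab ce; rewrite /side_edge /=; lia); lra.
Qed.

Lemma proper_meet_swap s t a b c e :
  proper_meet s t (swap a) (swap b) (swap c) (swap e) ->
  proper_meet s t a b c e.
Proof.
case: a b c e => [a1 a2] [b1 b2] [c1 c2] [x1 x2].
by case=> [|[[-> ->] [-> ->]]]; [left|right].
Qed.

Lemma oriented_edges_meet s t a b c e : 0 <= s <= 1 -> 0 <= t <= 1 ->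
  oriented_edge m J K d a b -> oriented_edge m J K d c e ->
  cross_at s t a b c e -> proper_meet s t a b c e.
Proof.
(* By the strict inequalities, no core edge is contained in one of the separating lines x = m and y
   = m. *)
have core_in u v : core_edge m d u v ->
    [/\ (u.1 <= m)%N, (v.1 <= m)%N & (u.1 < m)%N || (v.1 < m)%N] /\
    [/\ (u.2 <= m)%N, (v.2 <= m)%N & (u.2 < m)%N || (v.2 < m)%N].
  rewrite /core_edge /strip_edge /diagonal_edge /in_core => uv.
  by split; split; lia.
move=> s01 t01 /or3P[ab|ab|ab] /or3P[ce|ce|ce] x.
- exact: (core_edges_meet s01 t01 ab ce).
- by have [[? ? ?] _] := core_in _ _ ab; apply: (core_side_meet s01 t01 _ _ _ ce).
- have [_ [? ? ?]] := core_in _ _ ab; apply: proper_meet_swap.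
  exact: (core_side_meet s01 t01 _ _ _ ce (cross_at_swap x)).
- have [[? ? ?] _] := core_in _ _ ce; apply: proper_meet_sym.
  exact: (core_side_meet t01 s01 _ _ _ ab (cross_at_sym x)).
- exact: (side_edges_meet s01 t01 ab ce).
- exact: side_top_meet.
- have [_ [? ? ?]] := core_in _ _ ce; apply/proper_meet_swap/proper_meet_sym.
  exact: (core_side_meet t01 s01 _ _ _ ab (cross_at_sym (cross_at_swap x))).
- apply: proper_meet_sym; exact: (side_top_meet t01 s01 ce ab (cross_at_sym x)).
- apply: proper_meet_swap.
  exact: (side_edges_meet s01 t01 ab ce (cross_at_swap x)).
Qed.
End Meeting.

(** * From cycles of lattice points to closed broken lines *)

Section ClosedLine.
Variable R : realType.
Implicit Types (a b c e : nat * nat) (p : R * R).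

Definition embed a : R * R := (a.1.+1%:R, a.2.+1%:R).

(** The last alternative, an edge traversed backwards, is ruled out only later, from the length of
    the cycle. *)
Definition meet_properly a b c e := forall p,
  segment (embed a) (embed b) p -> segment (embed c) (embed e) p ->
  [\/ (p = embed a \/ p = embed b) /\ (p = embed c \/ p = embed e),
      a = c /\ b = e | a = e /\ b = c].

Lemma embed_inj : injective embed.
Proof.
move=> [a1 a2] [b1 b2] [] /eqP h1 /eqP h2; move: h1 h2; rewrite !eqr_nat.
by move=> /eqP[->] /eqP[->].
Qed.

Lemma segment_sym (x y p : R * R) : segment x y p -> segment y x p.
Proof.
case=> t /andP[t0 t1] ->; exists (1 - t); first by apply/andP; split; lra.
by congr pair; ring.
Qed.

Lemma meet_properly_revl a b c e : meet_properly a b c e -> meet_properly b a c e.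
Proof.
move=> H p /segment_sym x y; case: (H p x y) => [[h1 h2]|[-> ->]|[-> ->]].
- by constructor 1; split => //; case: h1; [right|left].
- by constructor 3.
- by constructor 2.
Qed.

Lemma meet_properly_revr a b c e : meet_properly a b c e -> meet_properly a b e c.
Proof.
move=> H p x /segment_sym y; case: (H p x y) => [[h1 h2]|[-> ->]|[-> ->]].
- by constructor 1; split => //; case: h2; [right|left].
- by constructor 3.
- by constructor 2.
Qed.

Lemma oriented_meet_properly m J K d a b c e :
  (J.+2 <= m)%N -> (K.+2 <= m)%N ->
  oriented_edge m J K d a b -> oriented_edge m J K d c e ->
  meet_properly a b c e.
Proof.
move=> Jm Km ab ce p [s s01 ->] [t t01] /= [].
rewrite -!natr1 => e1 e2.
have x : cross_at s t a b c e by split; lra.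
case: (oriented_edges_meet Jm Km s01 t01 ab ce x) => [[s_end t_end]|]; last first.
  by constructor 2.
constructor 1; split.
  by case: s_end => ->; [left|right]; rewrite /embed -!natr1; congr pair; ring.
rewrite e1 e2.
by case: t_end => ->; [left|right]; rewrite /embed -!natr1; congr pair; ring.
Qed.

Lemma tour_edge_meet_properly m J K d a b c e :
  (J.+2 <= m)%N -> (K.+2 <= m)%N ->
  tour_edge m J K d a b -> tour_edge m J K d c e -> meet_properly a b c e.
Proof.
move=> Jm Km /orP[ab|ab] /orP[ce|ce].
- exact: oriented_meet_properly ab ce.
- exact/meet_properly_revr/(oriented_meet_properly _ _ ab ce).
- exact/meet_properly_revl/(oriented_meet_properly _ _ ab ce).
- exact/meet_properly_revl/meet_properly_revr/(oriented_meet_properly _ _ ab ce).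
Qed.

Definition sqlen a b : R := (b.1%:R - a.1%:R) ^+ 2 + (b.2%:R - a.2%:R) ^+ 2.

Fixpoint pathlen a s : R :=
  if s is b :: s' then sqlen a b + pathlen b s' else 0.

Lemma pathlen_cat a s1 s2 :
  pathlen a (s1 ++ s2) = pathlen a s1 + pathlen (last a s1) s2.
Proof. by elim: s1 a => [|b s1 IH] a /=; rewrite ?add0r // IH addrA. Qed.

Lemma pathlen_sum x0 a s :
  pathlen a s =
  \sum_(i < size s) sqlen (nth x0 (a :: s) i) (nth x0 s i).
Proof.
elim: s a => [|b s IH] a /=; first by rewrite big_ord0.
by rewrite big_ord_recl /= IH.
Qed.

(** In a cycle without repetition, two distinct edges have distinct starts and distinct ends, so a
    shared vertex is the end of one and the start of the other, and the edges are consecutive. *)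
Lemma closed_broken_line_of_cycle m (r : rel (nat * nat)) x0 s :
  (forall a b c e, r a b -> r c e -> meet_properly a b c e) ->
  path r x0 (rcons s x0) -> uniq (x0 :: s) ->
  (size s).+1 = (m.+2 ^ 2)%N ->
  all (fun a => (a.1 < m.+2)%N && (a.2 < m.+2)%N) (x0 :: s) ->
  exists2 L : {ffun 'I_(m.+2 ^ 2) -> 'I_m.+2 * 'I_m.+2},
    closed_broken_line R L & sum_sq R L = pathlen x0 (rcons s x0).
Proof.
move=> Hr Hpath Huniq Hsize Hall.
pose N := (m.+2 ^ 2)%N; rewrite -/N in Hsize *.
pose v (i : nat) := nth x0 (x0 :: s) i.
pose L : {ffun 'I_N -> 'I_m.+2 * 'I_m.+2} :=
  [ffun i : 'I_N => (inord (v i).1, inord (v i).2)].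
have vE (i : 'I_N) : vertex R L i = embed (v i).
  rewrite /vertex /lattice_point /embed ffunE /=.
  have /(all_nthP x0) /(_ i) := Hall; rewrite /= Hsize => /(_ (ltn_ord i)).
  by case/andP=> h1 h2; rewrite !inordK.
have v_inj (i j : 'I_N) : v i = v j -> i = j.
  move=> vij; apply/val_inj/eqP.
  by rewrite -(nth_uniq x0 (s := x0 :: s)) /= ?Hsize ?ltn_ord //; apply/eqP.
have L_inj : injective L.
  by move=> i j Lij; apply/v_inj/embed_inj; rewrite -!vE /vertex Lij.
have vS (i : 'I_N) : v (ordS i) = nth x0 (rcons s x0) i.
  rewrite /v /= nth_rcons; have : (i < (size s).+1)%N by rewrite Hsize ltn_ord.
  (* The last index wraps around to 0, matching the copy of [x0] appended to [s]. *)
  rewrite ltnS leq_eqVlt => /orP[/eqP iE|lt].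
    by rewrite iE ltnn eqxx Hsize modnn.
  by rewrite lt modn_small //; move: lt; rewrite -ltnS Hsize.
have vi (i : 'I_N) : v i = nth x0 (x0 :: rcons s x0) i.
  rewrite /v -rcons_cons nth_rcons /= Hsize ltn_ord //.
have rv (i : 'I_N) : r (v i) (v (ordS i)).
  rewrite vS vi; apply: (pathP x0 Hpath).
  by rewrite size_rcons Hsize ltn_ord.
exists L.
  split.
    apply: inj_card_bij => //.
    by rewrite card_prod !card_ord /N expnS expn1.
  move=> i j p ij; rewrite /edge !vE => pi pj.
  case: (Hr _ _ _ _ (rv i) (rv j) p pi pj) => [[pi' pj']|[e1 _]|[e1 e2]].
  - case: pi' pj' => -> [] /embed_inj e.
    + by move: ij; rewrite (v_inj _ _ e) eqxx.
    + by right; split; first exact: v_inj.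
    + by left; split; [apply: v_inj | rewrite e].
    + move: ij; rewrite -(inj_eq (@ordS_inj _)) (v_inj _ _ e) eqxx //.
  - by move: ij; rewrite (v_inj _ _ e1) eqxx.
  (* A reversed edge would give i = i + 2 modulo [N], impossible since [N] is at least 4. *)
  - have i2 : i = ordS (ordS i).
      by rewrite {1}(v_inj _ _ e1) (v_inj _ _ e2).
    have /eqP := congr1 val i2; rewrite /= -[(_ %% _).+1]addn1 modnDml addn1.
    rewrite -{1}(modn_small (ltn_ord i)) -{1}[val i]addn0 -[i.+2]addn2 eqn_modDl.
    by rewrite mod0n modn_small // /N expnS expn1; lia.
rewrite /sum_sq (pathlen_sum x0).
have sE : size (rcons s x0) = N by rewrite size_rcons.
rewrite -(big_mkord xpredT (fun i => sqlen (nth x0 (x0 :: rcons s x0) i) (nth x0 (rcons s x0) i))).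
rewrite sE big_mkord; apply: eq_bigr => i _.
rewrite -vi -vS !vE /sqdist /sqlen /embed /= -!natr1; ring.
Qed.
End ClosedLine.

(** * The polygon *)

Section Lists.
Local Open Scope nat_scope.
Variable T : eqType.
Implicit Types (r : rel T) (P A B : nat -> T) (i j : nat) (p : pred T).

(** As in [path], the starting vertex ([P i] here, [A i] in [zigzag]) is left out, so that the
    pieces concatenate. *)
Fixpoint descend P i := if i is i'.+1 then P i' :: descend P i' else [::].

Fixpoint zigzag A B i :=
  if i is i'.+1 then B i :: A i' :: zigzag A B i' else [::].

Lemma path_descend r P i : (forall j, j < i -> r (P j.+1) (P j)) ->
  path r (P i) (descend P i).
Proof.
by elim: i => //= i IH h; rewrite h //= IH // => j ji; apply: h; apply: ltnW.
Qed.

Lemma last_descend P i : last (P i) (descend P i) = P 0.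
Proof. by elim: i => //= i ->. Qed.

Lemma size_descend P i : size (descend P i) = i.
Proof. by elim: i => //= i ->. Qed.

Lemma mem_descend P i j : j < i -> P j \in descend P i.
Proof.
elim: i => // i IH; rewrite ltnS leq_eqVlt inE => /orP[/eqP->|/IH->].
  by rewrite eqxx.
by rewrite orbT.
Qed.

Lemma all_descend p P i : (forall j, j < i -> p (P j)) -> all p (descend P i).
Proof.
by elim: i => //= i IH h; rewrite h //= IH // => j ji; apply: h; apply: ltnW.
Qed.

Lemma path_zigzag r A B i :
  (forall j, j < i -> r (A j.+1) (B j.+1) && r (B j.+1) (A j)) ->
  path r (A i) (zigzag A B i).
Proof.
elim: i => //= i IH h; have /andP[-> ->] /= := h i (leqnn _).
by rewrite IH // => j ji; apply: h; apply: ltnW.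
Qed.

Lemma last_zigzag A B i : last (A i) (zigzag A B i) = A 0.
Proof. by elim: i => //= i ->. Qed.

Lemma size_zigzag A B i : size (zigzag A B i) = i.*2.
Proof. by elim: i => //= i ->. Qed.

Lemma mem_zigzag_l A B i j : j < i -> A j \in zigzag A B i.
Proof.
elim: i => // i IH; rewrite ltnS leq_eqVlt !inE => /orP[/eqP->|/IH->].
  by rewrite eqxx orbT.
by rewrite !orbT.
Qed.

Lemma mem_zigzag_r A B i j : j < i -> B j.+1 \in zigzag A B i.
Proof.
elim: i => // i IH; rewrite ltnS leq_eqVlt !inE => /orP[/eqP->|/IH->].
  by rewrite eqxx.
by rewrite !orbT.
Qed.

Lemma all_zigzag p A B i :
  (forall j, j < i -> p (B j.+1) && p (A j)) -> all p (zigzag A B i).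
Proof.
elim: i => //= i IH h; have /andP[-> ->] /= := h i (leqnn _).
by rewrite IH // => j ji; apply: h; apply: ltnW.
Qed.
End Lists.

(** * The tour and its passage through every grid point exactly once *)

Section Construction.
Local Open Scope nat_scope.
Variables m J K : nat.
Hypotheses (J0 : 0 < J) (K0 : 0 < K) (Jm : J.+2 <= m) (Km : K.+2 <= m).

(* Here n = m + 2 and the coordinates are 0, ..., m + 1. Line k, for
   0 <= k <= 2m, is x - y = k - m; its points in the core are those with
   lineL k <= x <= lineR k, the endpoints left to the two sides being dropped.
   In the strip between the lines k and k + 1, [low k i] and [high k i] are the
   vertices of the zigzag, for 0 <= i <= third k. *)
Definition lineL k := k - m.
(** The dropped right end is (k, m) for 0 < k <= K in the lower half, and (m, 2m - k) for 0 < 2m - k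
    <= J in the upper half. *)
Definition lineR k :=
  if k <= m then k - ((0 < k) && (k <= K)) else m - ((k < m.*2) && (m.*2 <= k + J)).
Definition gap k := lineR k.+1 - lineL k.
(** With g the gap, 2q zigzag edges along which x changes by about g - q contribute about 4q(g -
    q)^2, which is largest at q = g/3. *)
Definition third k := gap k %/ 3.
Definition offset k := gap k - third k.
(* The subtraction is exact for the points of line k. *)
Definition pt k x := (x, x + m - k).
Definition low k i := pt k (lineL k + i).
Definition high k i := pt k.+1 (lineR k.+1 - third k + i).
Definition rest k := lineR k.+1 - third k - lineL k.+1 - third k.+1.
Definition mid k i := low k (third k + i).

(** The pieces fit because [high k' 0] is [mid k (rest k')], where the descent starts, and the
    descent ends at [mid k 0], where the next zigzag starts. *)
Fixpoint core k :=
  if k is k'.+1 then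
    core k' ++ zigzag (low k') (high k') (third k') ++
      high k' 0 :: descend (mid k) (rest k')
  else [::].

(** From (m + 1, 0) up the last column to the corner (m + 1, m + 1), then left along the last row to
    (0, m + 1), one unit away from the start (0, m). *)
Definition tour_tail :=
  (m.+1, 0) :: descend (fun i => (m.+1, m.+1 - J - i)) (m.+1 - J) ++
  zigzag (fun i => (m.+1, m.+1 - i)) (fun i => (m, J - i + 1)) J ++
  zigzag (fun i => (m.+1 - K + i, m.+1)) (fun i => (i, m)) K ++
  descend (fun i => (i, m.+1)) (m.+1 - K).

Definition tour := core m.*2 ++ tour_tail.

Lemma lineR_le k : lineR k <= m.
Proof. by rewrite /lineR; case: ifP => h; lia. Qed.

Lemma lineR_lek k : lineR k <= k.
Proof. by rewrite /lineR; case: ifP => h; lia. Qed.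

Lemma lineR1 : lineR 1 = 0.
Proof. by rewrite /lineR; case: ifP => h; lia. Qed.

Lemma gapE k : k < m.*2 -> lineL k + gap k = lineR k.+1.
Proof. by rewrite /gap /lineR /lineL; case: ifP => h; lia. Qed.

Lemma gap_last : gap m.*2 = 0.
Proof. by rewrite /gap /lineR /lineL; case: ifP => ?; lia. Qed.

Lemma third_bound k : third k * 3 <= gap k.
Proof. exact: leq_trunc_div. Qed.

Lemma lineR_step k : k < m.*2 ->
  [/\ lineL k <= lineR k, lineR k.+1 <= (lineR k).+2 & lineL k.+1 <= lineR k.+1].
Proof.
rewrite /lineR /lineL => km.
by case: ifP => ?; case: ifP => ?; split; lia.
Qed.

(** The two zigzags adjacent to line k + 1 use disjoint parts of it: if x spans a range l there, the
    gaps are at most l + 1 and l + 2, and floor((l + 1)/3) + floor((l + 2)/3) <= l. *)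
Lemma restE k : k < m.*2 ->
  rest k + third k + third k.+1 + lineL k.+1 = lineR k.+1.
Proof.
move=> km; have [_ _ h1] := lineR_step km.
have h2 : gap k <= (lineR k.+1 - lineL k.+1).+1.
  by rewrite /gap /lineL in h1 *; lia.
have h3 : gap k.+1 <= (lineR k.+1 - lineL k.+1).+2.
  rewrite /gap; move: km; rewrite leq_eqVlt => /orP[/eqP ->|km].
    by rewrite -[_ - _]/(gap m.*2) gap_last.
  by have [_ h _] := lineR_step km; lia.
rewrite /rest /third; move: (gap k) (gap _) (lineR _) (lineL _) h1 h2 h3.
move=> a b x y; lia.
Qed.

Local Notation tedge := (tour_edge m J K offset).

Lemma third0 : third 0 = 0.
Proof. by rewrite /third /gap lineR1. Qed.

Lemma third_last : third m.*2 = 0.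
Proof. by rewrite /third gap_last. Qed.

Lemma level_low k i : level m (low k i) = k.
Proof. by rewrite /level /low /pt /lineL /=; lia. Qed.

(** Along the edge x grows by [offset k] + (j - i), where j - i is 0 or 1. *)
Lemma low_high k i j : k < m.*2 -> i <= third k -> i <= j <= i.+1 -> j <= third k ->
  strip_edge m offset (low k i) (high k j).
Proof.
move=> km ik ij jk; have := gapE km; have := third_bound k.
have := lineR_le k.+1; have := lineR_lek k.+1.
(* The first edge starts at (0, m) and must leave y = m; it does because (1, m) has been given to
   the top side. *)
have : k = 0 -> lineR k.+1 = 0 by move=> ->; exact: lineR1.
have lev := level_low k i; have [_ _] := lineR_step km.
rewrite /strip_edge /in_core lev /offset /low /high /pt /level /=.
move: (lineR _) (gap _) (third _) ik jk => x g t; rewrite /lineL; lia.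
Qed.

Lemma low_high_edge k i j :
  k < m.*2 -> i <= third k -> i <= j <= i.+1 -> j <= third k ->
  tedge (low k i) (high k j) && tedge (high k j) (low k i).
Proof.
move=> *; rewrite /tour_edge /oriented_edge /core_edge low_high //.
by rewrite !orbT.
Qed.

Lemma core_path k : k <= m.*2 ->
  path tedge (0, m) (core k) /\ last (0, m) (core k) = mid k 0.
Proof.
elim: k => [|k IH] km /=.
  by split=> //; rewrite /mid /low third0 /pt /lineL; congr pair; lia.
have [IHp IHl] := IH (ltnW km).
have midE : mid k 0 = low k (third k) by rewrite /mid addn0.
have hiE : high k 0 = mid k.+1 (rest k).
  rewrite /high /mid /low; congr pt; have := restE km; lia.
rewrite !cat_path !last_cat IHp IHl midE /= last_zigzag.
split; last by rewrite hiE last_descend.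
rewrite path_zigzag /=; last first.
  move=> j jk.
  have /andP[-> _] : tedge (low k j.+1) (high k j.+1) && tedge (high k j.+1) (low k j.+1).
    by apply: low_high_edge => //; lia.
  have /andP[_ ->] // : tedge (low k j) (high k j.+1) && tedge (high k j.+1) (low k j).
  by apply: low_high_edge => //; lia.
have /andP[-> _] /= : tedge (low k 0) (high k 0) && tedge (high k 0) (low k 0).
  by apply: low_high_edge.
rewrite hiE; apply: path_descend => j jr; rewrite /tour_edge orbC /oriented_edge /core_edge.
apply/orP; left; apply/orP; left; apply/orP; right.
have := restE km; have := lineR_le k.+1; have := lineR_lek k.+1.
rewrite /diagonal_edge /in_core /mid /low /pt /= /lineL; lia.
Qed.

Lemma side_tour_edge a b :
  [|| side_edge m J a b, side_edge m J b a,
      side_edge m K (swap a) (swap b) | side_edge m K (swap b) (swap a)] ->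
  tedge a b.
Proof.
by rewrite /tour_edge /oriented_edge => /or4P[] ->; rewrite ?orbT.
Qed.

Lemma core_end : mid m.*2 0 = (m, 0).
Proof. by rewrite /mid /low /pt third_last /lineL; congr pair; lia. Qed.

Lemma tour_path : path tedge (0, m) (rcons tour (0, m)).
Proof.
have [cp cl] := core_path (leqnn _).
rewrite rcons_cat cat_path cp cl core_end /= !rcons_cat.
apply/andP; split; first by apply: side_tour_edge; rewrite /side_edge /=; lia.
have -> : (m.+1, 0) = (m.+1, m.+1 - J - (m.+1 - J)) by rewrite subnn.
rewrite cat_path path_descend; last first.
  by move=> j jm; apply: side_tour_edge; rewrite /side_edge /=; lia.
rewrite (last_descend (fun i => (m.+1, m.+1 - J - i))) subn0.
rewrite cat_path (path_zigzag (A := fun i => (m.+1, m.+1 - i))); last first.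
  by move=> j jm; apply/andP; split; apply: side_tour_edge; rewrite /side_edge /=; lia.
rewrite (last_zigzag (fun i => (m.+1, m.+1 - i))) subn0.
have -> : (m.+1, m.+1) = (m.+1 - K + K, m.+1) by congr pair; lia.
rewrite cat_path (path_zigzag (A := fun i => (m.+1 - K + i, m.+1))); last first.
  by move=> j jm; apply/andP; split; apply: side_tour_edge; rewrite /side_edge /=; lia.
rewrite (last_zigzag (fun i => (m.+1 - K + i, m.+1))) addn0.
rewrite rcons_path (path_descend (P := fun i => (i, m.+1))) /=; last first.
  by move=> j jm; apply: side_tour_edge; rewrite /side_edge /=; lia.
rewrite (last_descend (fun i => (i, m.+1))).
by apply: side_tour_edge; rewrite /side_edge /=; lia.
Qed.

Lemma mem_core_mono k k' a : k <= k' -> a \in core k -> a \in core k'.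
Proof.
elim: k' => [|k' IH]; first by rewrite leqn0 => /eqP ->.
by rewrite leq_eqVlt => /orP[/eqP->//|/IH h /h]; rewrite /= mem_cat => ->.
Qed.

Lemma mem_core k x : k <= m.*2 -> lineL k <= x <= lineR k ->
  pt k x \in (0, m) :: core m.*2.
Proof.
move=> km /andP[Lx xR]; have [xl|xl] := ltnP x (lineL k + third k).
  have km' : k < m.*2.
    by move: km; rewrite leq_eqVlt => /orP[/eqP e|//]; rewrite e third_last in xl Lx; lia.
  rewrite inE; apply/orP; right; apply: (mem_core_mono (k := k.+1)) => //=.
  rewrite !mem_cat; apply/orP; right; apply/orP; left.
  rewrite (_ : pt k x = low k (x - lineL k)); last by rewrite /low subnKC.
  by apply: mem_zigzag_l; lia.
case: k km Lx xR xl => [|k] km Lx xR xl.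
  have -> : x = 0 by have := lineR_lek 0; lia.
  by rewrite inE /pt add0n subn0 eqxx.
rewrite inE; apply/orP; right; apply: (mem_core_mono km) => /=.
rewrite !mem_cat; apply/orP; right; have := restE km => rE.
have [xr|xr] := ltnP (lineR k.+1 - third k) x.
  apply/orP; left; pose j := x - (lineR k.+1 - third k) - 1.
  have -> : pt k.+1 x = high k j.+1 by rewrite /high /j; congr pt; lia.
  by apply: mem_zigzag_r; rewrite /j; lia.
apply/orP; right; rewrite inE; move: xr; rewrite leq_eqVlt => /orP[/eqP xr|xr].
  by apply/orP; left; rewrite /high addn0 xr.
apply/orP; right; pose j := x - lineL k.+1 - third k.+1.
have -> : pt k.+1 x = mid k.+1 j by rewrite /mid /low /j; congr pt; lia.
by apply: mem_descend; rewrite /j; lia.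
Qed.

Lemma mem_tour a : a.1 < m.+2 -> a.2 < m.+2 -> a \in (0, m) :: tour.
Proof.
case: a => x y /= xm ym.
have [xE|xE] := eqVneq x m.+1.
  rewrite -cat_cons mem_cat; apply/orP; right; rewrite xE.
  rewrite inE !mem_cat; have [->|y0] := posnP y; first by rewrite eqxx.
  apply/orP; right; have [yJ|yJ] := leqP y (m.+1 - J).
    apply/orP; left; rewrite {1}(_ : y = m.+1 - J - (m.+1 - J - y)); last by lia.
    by apply: (mem_descend (fun i => (m.+1, m.+1 - J - i))); lia.
  apply/orP; right; apply/orP; left.
  rewrite {1}(_ : y = m.+1 - (m.+1 - y)); last by lia.
  by apply: (mem_zigzag_l (fun i => (m.+1, m.+1 - i))); lia.
have [yE|yE] := eqVneq y m.+1.
  rewrite -cat_cons mem_cat; apply/orP; right; rewrite yE.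
  rewrite inE !mem_cat; have [xK|xK] := ltnP x (m.+1 - K).
    do 4 (apply/orP; right).
    by apply: (mem_descend (fun i => (i, m.+1))); lia.
  do 3 (apply/orP; right); apply/orP; left.
  rewrite {1}(_ : x = m.+1 - K + (x - (m.+1 - K))); last by lia.
  by apply: (mem_zigzag_l (fun i => (m.+1 - K + i, m.+1))); lia.
have [/and3P[/eqP xm' y0 yJ]|xyJ] := boolP [&& x == m, 0 < y & y <= J].
  rewrite -cat_cons mem_cat; apply/orP; right; rewrite inE !mem_cat.
  do 2 (apply/orP; right); apply/orP; left.
  rewrite {1}(_ : y = J - (J - y).+1 + 1) ?xm'; last by lia.
  by apply: (mem_zigzag_r _ (fun i => (m, J - i + 1))); lia.
have [/and3P[/eqP ym' x0 xK]|xyK] := boolP [&& y == m, 0 < x & x <= K].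
  rewrite -cat_cons mem_cat; apply/orP; right; rewrite inE !mem_cat.
  do 3 (apply/orP; right); apply/orP; left.
  rewrite {1}(_ : x = x.-1.+1) ?ym'; last by lia.
  by apply: (mem_zigzag_r _ (fun i => (i, m))); lia.
rewrite -cat_cons mem_cat; apply/orP; left.
have -> : (x, y) = pt (x + m - y) x by rewrite /pt; congr pair; lia.
apply: mem_core; first by lia.
by rewrite /lineR /lineL; case: ifP => h; lia.
Qed.

Lemma tour_in_grid : all (fun a => (a.1 < m.+2) && (a.2 < m.+2)) ((0, m) :: tour).
Proof.
rewrite /= ltnW //= all_cat; apply/andP; split.
  have : m.*2 <= m.*2 by [].
  elim: {1 3}(m.*2) => //= k IH km.
  have := lineR_le k.+1; have := lineR_lek k.+1; have := restE km; have := gapE km.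
  have := third_bound k => g3 gE rE r1 r2.
  rewrite all_cat IH ?(ltnW km) //= all_cat all_zigzag /=; last first.
    by move=> j jk; rewrite /high /low /pt /lineL in gE rE *; lia.
  apply/andP; split; first by rewrite addn0 /lineL in rE *; lia.
  by apply: all_descend => j jr; rewrite /mid /low /pt /lineL /= in rE *; lia.
rewrite /= !all_cat !all_descend ?all_zigzag //= => *; lia.
Qed.

(** [core k] stops at [mid k 0]; the [third k] points of line k beyond it are left to the zigzag of
    strip k. *)
Lemma size_core k : k <= m.*2 ->
  size (core k) + third k = \sum_(j < k) (lineR j.+1 - lineL j.+1).+1.
Proof.
elim: k => [|k IH] km; first by rewrite big_ord0 third0.
rewrite big_ord_recr -IH /= ?(ltnW km) //; have := restE km.
rewrite !size_cat size_zigzag /= size_descend; lia.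
Qed.

Lemma lineR_sub_lower k : k < m -> lineR k.+1 - lineL k.+1 = k.+1 - (k < K).
Proof. by move=> km; rewrite /lineR /lineL km; lia. Qed.

Lemma lineR_sub_upper k : k < m ->
  lineR (m + k).+1 - lineL (m + k).+1 = m - k.+1 - ((k.+1 < m) && (m <= k.+1 + J)).
Proof. by move=> km; rewrite /lineR /lineL; case: ifP => h; lia. Qed.

(** The core has (m + 1)^2 - J - K points on 2m + 1 lines, and each line is counted with one point
    less. *)
Lemma sum_line_sizes :
  \sum_(j < m.*2) (lineR j.+1 - lineL j.+1) + J + K = m * m.
Proof.
(* The [minn] terms here and in [upper] count the dropped ends; doubling avoids halves of k(k +
   1). *)
have lower k : k <= m -> (\sum_(j < k) (lineR j.+1 - lineL j.+1)).*2 +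
    (minn k K).*2 = k * k.+1.
  elim: k => [|k IH] km; first by rewrite big_ord0 min0n.
  rewrite big_ord_recr /= lineR_sub_lower //; have := IH (ltnW km).
  by move: (\sum_(j < k) _) => S; case: (ltnP k K) => kK /=; nia.
have upper k : k <= m ->
    (\sum_(j < k) (lineR (m + j).+1 - lineL (m + j).+1)).*2 +
    (minn k m.-1 - (m.-1 - J)).*2 + k * k.+1 = (m * k).*2.
  elim: k => [|k IH] km; first by rewrite big_ord0 muln0 min0n.
  rewrite big_ord_recr /= lineR_sub_upper //; have := IH (ltnW km).
  by move: (\sum_(j < k) _) => S; case: andP => h /=; nia.
rewrite -addnn big_split_ord /=; have := lower _ (leqnn m).
have := upper _ (leqnn m).
by move: (\sum_(j < m) _) (\sum_(j < m) _) => S S'; nia.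
Qed.

Lemma size_tour : (size tour).+1 = m.+2 ^ 2.
Proof.
have := size_core (leqnn m.*2); rewrite third_last addn0.
under eq_bigr do rewrite -addn1.
rewrite big_split /= sum1_card card_ord => sE; have := sum_line_sizes.
rewrite /tour size_cat sE /= !size_cat !size_descend !size_zigzag expnS expn1.
by move: (\sum_(j < _) _) => S; lia.
Qed.

(** By counting: a list that contains all (m + 2)^2 grid points and has just that many entries
    cannot repeat any. *)
Lemma tour_uniq : uniq ((0, m) :: tour).
Proof.
pose g := [seq (x, y) | x <- iota 0 m.+2, y <- iota 0 m.+2].
apply: (@leq_size_uniq _ g).
- by apply: allpairs_uniq; rewrite ?iota_uniq // => -[? ?] [? ?].
- move=> a /allpairsP[[x y] [xI yI ->]]; move: xI yI; rewrite !mem_iota.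
  by move=> xm ym; apply: mem_tour.
- by rewrite size_allpairs !size_iota /= size_tour expnS expn1.
Qed.
End Construction.

(** * The sum of the squared edge lengths *)

Section Cost.
Variable R : realType.

Lemma sqlenC a b : sqlen R a b = sqlen R b a.
Proof. by rewrite /sqlen; ring. Qed.

Lemma pathlen_descend (P : nat -> nat * nat) i (c : R) :
  (forall j, (j < i)%N -> sqlen R (P j.+1) (P j) = c) ->
  pathlen R (P i) (descend P i) = c * i%:R.
Proof.
elim: i => /= [_|i IH h]; first by rewrite mulr0.
rewrite h // IH => [|j ji]; last by apply: h; apply: ltnW.
by rewrite -natr1; ring.
Qed.

Lemma pathlen_zigzag (A B : nat -> nat * nat) i (c1 c2 : R) :
  (forall j, (j < i)%N -> sqlen R (A j.+1) (B j.+1) = c1) ->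
  (forall j, (j < i)%N -> sqlen R (B j.+1) (A j) = c2) ->
  pathlen R (A i) (zigzag A B i) = (c1 + c2) * i%:R.
Proof.
elim: i => /= [_ _|i IH h1 h2]; first by rewrite mulr0.
rewrite h1 // h2 // IH => [|j ji|j ji]; first by rewrite -natr1; ring.
  by apply: h1; apply: ltnW.
by apply: h2; apply: ltnW.
Qed.

Lemma sqlen_pt m k x y : (k <= x + m)%N -> (k < y + m)%N ->
  sqlen R (pt m k x) (pt m k.+1 y) =
  (y%:R - x%:R) ^+ 2 + (y%:R - x%:R - 1) ^+ 2.
Proof.
move=> kx ky; rewrite /sqlen /pt /= !natrB // !natrD -natr1; ring.
Qed.

Lemma sqlen_diag m k x : (k <= x + m)%N ->
  sqlen R (pt m k x.+1) (pt m k x) = 2.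
Proof.
move=> kx; rewrite /sqlen /pt /= !natrB //; last by lia.
rewrite !natrD -natr1; ring.
Qed.

(* The zigzag of a strip in which x can grow by at most D, minus 2 for each
   of the 2 * (D %/ 3) unit diagonal steps which it saves. *)
Definition strip_value (D : nat) : R :=
  let q := (D %/ 3)%:R in let d := (D - D %/ 3)%:R in
  q * (4 * d ^+ 2 + 2) + (2 * d ^+ 2 - 2 * d + 1) - 4 * q.

Section Tour.
Variables m J K : nat.
Hypotheses (J0 : (0 < J)%N) (K0 : (0 < K)%N) (Jm : (J.+2 <= m)%N) (Km : (K.+2 <= m)%N).

Local Notation lineR := (lineR m J K).
Local Notation lineL := (lineL m).
Local Notation gap := (gap m J K).
Local Notation third := (third m J K).
Local Notation core := (core m J K).

(** The second sum charges 2 for every diagonal step of every line, and [strip_value] refunds the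
    steps saved on both lines of its strip. The term in [third k] stands for the steps of line k
    saved by strip k, which is not yet traversed. *)
Lemma pathlen_core k : (k <= m.*2)%N ->
  pathlen R (0%N, m) (core k) + 2 * (third k)%:R =
  \sum_(j < k) strip_value (gap j) +
  2 * (\sum_(j < k) (lineR j.+1 - lineL j.+1))%:R.
Proof.
elim: k => [|k IH] km; first by rewrite !big_ord0 third0 //=; ring.
rewrite !big_ord_recr natrD mulrDr.
have {IH} := IH (ltnW km).
set S := (\sum_(i < k) strip_value _).
set S' := (\sum_(i < k) (_ - _)%N)%:R => IH.
have [_ cl] := core_path J0 K0 Jm Km (ltnW km).
have lowE : mid m J K k 0 = low m k (third k) by rewrite /mid addn0.
have hiE : high m J K k 0 = mid m J K k.+1 (rest m J K k).
  rewrite /high /mid /low; congr pt; have := restE J0 K0 Jm Km km; lia.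
have g3 := third_bound m J K k; have gE := gapE J0 K0 Jm Km km.
have rE := restE J0 K0 Jm Km km.
have tg : (third k <= gap k)%N by lia.
have dE : (gap k)%:R = (offset m J K k)%:R + (third k)%:R :> R.
  by rewrite -natrD; congr (_%:R); rewrite /offset; lia.
have hl i j : (i <= j <= i.+1)%N -> (j <= third k)%N ->
    sqlen R (low m k i) (high m J K k j) =
    ((offset m J K k)%:R + (j%:R - i%:R)) ^+ 2 +
    ((offset m J K k)%:R + (j%:R - i%:R) - 1) ^+ 2.
  move=> ij jk; rewrite /low /high sqlen_pt; last 2 first.
  - by rewrite /lineL; lia.
  - by rewrite /lineL in rE *; lia.
  suff -> : (lineR k.+1 - third k + j)%:R - (lineL k + i)%:R =
      (offset m J K k)%:R + (j%:R - i%:R) :> R by [].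
  by rewrite -gE !natrD natrB ?natrD ?dE; [ring|lia].
rewrite /= !pathlen_cat cl lowE last_zigzag /=.
rewrite (pathlen_zigzag (c1 := (offset m J K k)%:R ^+ 2 + ((offset m J K k)%:R - 1) ^+ 2)
  (c2 := ((offset m J K k)%:R + 1) ^+ 2 + (offset m J K k)%:R ^+ 2)); first last.
- by move=> j jk; rewrite sqlenC hl //; [rewrite -natr1; ring|lia].
- by move=> j jk; rewrite hl //; [rewrite subrr !addr0|lia].
rewrite hl // hiE (pathlen_descend (c := 2)) => [|j jr]; last first.
  by rewrite /mid /low !addnS sqlen_diag // /lineL; lia.
have -> : (lineR k.+1 - lineL k.+1)%:R =
    (rest m J K k)%:R + (third k)%:R + (third k.+1)%:R :> R.
  by rewrite -!natrD; congr (_%:R); lia.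
rewrite /strip_value -/(third k) -/(offset m J K k).
move: IH; lra.
Qed.
End Tour.

(** The argument of [f] runs through 0, ..., m with the value K skipped. *)
Lemma sum_skip (f : nat -> R) K m : (K <= m)%N ->
  \sum_(j < m) f (j.+1 - (j < K))%N + f K = \sum_(j < m.+1) f j.
Proof.
elim: m => [|m IH] Km.
  by move: Km; rewrite leqn0 => /eqP ->; rewrite big_ord0 big_ord1 add0r.
move: Km; rewrite leq_eqVlt => /orP[/eqP ->|Km].
  rewrite [RHS]big_ord_recr; congr (_ + _); apply: eq_bigr => j _.
  by rewrite ltn_ord subn1.
rewrite big_ord_recr [RHS]big_ord_recr -IH //=.
by rewrite ltnNge -ltnS Km subn0; ring.
Qed.

(** The gaps of the lower half are 0, ..., m without K; those of the upper half, read backwards, are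
    0, ..., m without J + 1, up to one harmless change. *)
Lemma sum_strip_value m J K :
  (0 < J)%N -> (0 < K)%N -> (J.+2 <= m)%N -> (K.+2 <= m)%N ->
  \sum_(j < m.*2) strip_value (gap m J K j) =
  2 * \sum_(j < m.+1) strip_value j - strip_value K - strip_value J.+1.
Proof.
move=> J0 K0 Jm Km; rewrite -addnn big_split_ord /=.
have lower : \sum_(j < m) strip_value (gap m J K j) + strip_value K =
    \sum_(j < m.+1) strip_value j.
  rewrite -(sum_skip strip_value (K := K)); last by lia.
  congr (_ + _); apply: eq_bigr => j _; congr strip_value.
  have jm := ltn_ord j; rewrite /gap; have := lineR_sub_lower J0 K0 Jm Km jm.
  by rewrite /lineL; lia.
have upper : \sum_(j < m) strip_value (gap m J K (m + j)) + strip_value J.+1 =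
    \sum_(j < m.+1) strip_value j.
  rewrite -(sum_skip strip_value (K := J.+1)); last by lia.
  congr (_ + _); rewrite (reindex_inj rev_ord_inj) /=.
  apply: eq_bigr => j _; have jm := ltn_ord j.
  have rm : (m - j.+1 < m)%N by lia.
  (* The very last strip has gap 1 where the pattern predicts 0, but [strip_value] is 1 at both. *)
  case: (posnP j) => [->|j0].
    have -> : gap m J K (m + (m - 1)) = 1%N.
      by rewrite /gap /lineR /lineL; case: ifP => h; lia.
    by rewrite /strip_value /= subnn !divn_small // subn0 subnn; ring.
  congr strip_value.
  by rewrite /gap /lineR /lineL; case: ifP => h; lia.
by rewrite -lower in upper *; lra.
Qed.

Lemma sum_strip_value_closed t :
  \sum_(j < 3 * t) strip_value j =
  12 * t%:R ^+ 4 - 11 * t%:R ^+ 2 + 6 * t%:R.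
Proof.
elim: t => [|t IH]; first by rewrite muln0 big_ord0; ring.
rewrite mulnS addnC addn3 3!big_ord_recr /= IH /strip_value.
have -> : (3 * t %/ 3 = t)%N by lia.
have -> : ((3 * t).+1 %/ 3 = t)%N by lia.
have -> : ((3 * t).+2 %/ 3 = t)%N by lia.
have -> : (3 * t - t = 2 * t)%N by lia.
have -> : ((3 * t).+1 - t = 2 * t + 1)%N by lia.
have -> : ((3 * t).+2 - t = 2 * t + 2)%N by lia.
have -> : (2 * t + 2)%:R = 2 * t%:R + 2 :> R by rewrite natrD natrM.
have -> : (2 * t + 1)%:R = 2 * t%:R + 1 :> R by rewrite natrD natrM.
by rewrite natrM -[t.+1%:R]natr1; ring.
Qed.

(** In [side I], the unit steps come first, then I pairs of zigzag edges of squared lengths (m -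
    I)^2 + 1 and (m - I + 1)^2 + 1. The final 2 is for the unit edges that link the core to the two
    sides. *)
Lemma pathlen_tour m J K :
  (0 < J)%N -> (0 < K)%N -> (J.+2 <= m)%N -> (K.+2 <= m)%N ->
  let side (I : nat) : R := m%:R + 1 - I%:R +
    (2 * (m%:R - I%:R) ^+ 2 + 2 * (m%:R - I%:R) + 3) * I%:R in
  pathlen R (0%N, m) (rcons (tour m J K) (0%N, m)) =
  2 * \sum_(j < m.+1) strip_value j - strip_value K - strip_value J.+1 +
  2 * (m%:R ^+ 2 - J%:R - K%:R) + side J + side K + 2.
Proof.
move=> J0 K0 Jm Km side.
have := pathlen_core J0 K0 Jm Km (leqnn _).
rewrite third_last // mulr0 addr0 sum_strip_value // => coreE.
have lineE : (\sum_(j < m.*2) (lineR m J K j.+1 - lineL m j.+1))%:R =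
    m%:R ^+ 2 - J%:R - K%:R :> R.
  have := sum_line_sizes J0 K0 Jm Km; move: (\sum_(j < _) _)%N => S SE.
  by rewrite expr2 -natrM -SE !natrD; ring.
have [_ cl] := core_path J0 K0 Jm Km (leqnn _).
rewrite rcons_cat pathlen_cat coreE lineE cl core_end //= !rcons_cat.
have -> : (m.+1, 0%N) = (m.+1, m.+1 - J - (m.+1 - J))%N by rewrite subnn.
rewrite pathlen_cat (pathlen_descend (P := fun i => (m.+1, m.+1 - J - i)%N) (c := 1));
  last first.
  move=> j jm; rewrite /sqlen /=.
  rewrite (_ : (m.+1 - J - j = (m.+1 - J - j.+1).+1)%N); last by lia.
  by rewrite -natr1; ring.
rewrite (last_descend (fun i => (m.+1, m.+1 - J - i)%N)) subn0.
rewrite pathlen_cat (pathlen_zigzag (A := fun i => (m.+1, m.+1 - i)%N)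
  (c1 := (m%:R - J%:R) ^+ 2 + 1) (c2 := (m%:R - J%:R + 1) ^+ 2 + 1)); first last.
- move=> j jm; rewrite /sqlen /= natrD !natrB ?subSn -?natr1; try lia.
  by rewrite -?natr1; ring.
- move=> j jm; rewrite /sqlen /= natrD !natrB ?subSn -?natr1; try lia.
  by rewrite -?natr1; ring.
rewrite (last_zigzag (fun i => (m.+1, m.+1 - i)%N)) subn0.
have -> : (m.+1, m.+1) = (m.+1 - K + K, m.+1)%N by congr pair; lia.
rewrite pathlen_cat (pathlen_zigzag (A := fun i => (m.+1 - K + i, m.+1)%N)
  (c1 := (m%:R - K%:R + 1) ^+ 2 + 1) (c2 := (m%:R - K%:R) ^+ 2 + 1)); first last.
- move=> j jm; rewrite /sqlen /= natrD !natrB -?natr1; try lia.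
  by ring.
- move=> j jm; rewrite /sqlen /= natrD !natrB -?natr1; try lia.
  by ring.
rewrite (last_zigzag (fun i => (m.+1 - K + i, m.+1)%N)) addn0.
rewrite -cats1 pathlen_cat (pathlen_descend (P := fun i => (i, m.+1)) (c := 1)) /=;
  last first.
  by move=> j jm; rewrite /sqlen /= -natr1; ring.
rewrite (last_descend (fun i => (i, m.+1))) /sqlen /= !natrB -?natr1; try lia.
rewrite /side; ring.
Qed.

End Cost.

(** * Evaluation of the length in each residue class modulo 9 *)

Section Final.
Variable R : realType.

Definition strip_poly (q e : R) : R :=
  q * (4 * (2 * q + e) ^+ 2 + 2) +
  (2 * (2 * q + e) ^+ 2 - 2 * (2 * q + e) + 1) - 4 * q.

Lemma strip_valueE q e : (e < 3)%N ->
  strip_value R (3 * q + e) = strip_poly q%:R e%:R.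
Proof.
move=> e3; rewrite /strip_value /strip_poly.
have -> : ((3 * q + e) %/ 3 = q)%N by lia.
have -> : (3 * q + e - q = 2 * q + e)%N by lia.
by rewrite natrD natrM.
Qed.

Lemma sum_strip_valueE t e : (e < 3)%N ->
  \sum_(j < 3 * t + e) strip_value R j =
  12 * t%:R ^+ 4 - 11 * t%:R ^+ 2 + 6 * t%:R +
  (0 < e)%N%:R * strip_poly t%:R 0 + (1 < e)%N%:R * strip_poly t%:R 1.
Proof.
case: e => [|[|[|//]]] _.
- by rewrite addn0 sum_strip_value_closed /=; ring.
- rewrite addn1 big_ord_recr /= sum_strip_value_closed.
  by have := strip_valueE t (isT : (0 < 3)%N); rewrite addn0 => ->; ring.
- rewrite addn2 !big_ord_recr /= sum_strip_value_closed.
  have := strip_valueE t (isT : (0 < 3)%N); rewrite addn0 => ->.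
  by have := strip_valueE t (isT : (1 < 3)%N); rewrite addn1 => ->; ring.
Qed.

Lemma cast_linear a s b : (a * s + b)%N%:R = a%:R * s%:R + b%:R :> R.
Proof. by rewrite natrD natrM. Qed.

(** [J] and [K] are thirds of n, and their strip values involve thirds again; so for fixed n modulo
    9 both sides are polynomials in one parameter, and they coincide. *)
Lemma alphaE m (J := (m.+2 %/ 3).-1) (K := (m.+3 %/ 3).-1)
    (side := fun I : nat => m%:R + 1 - I%:R +
      (2 * (m%:R - I%:R) ^+ 2 + 2 * (m%:R - I%:R) + 3) * I%:R : R) :
  (9 <= m.+2)%N ->
  alpha R m.+2 =
  2 * \sum_(j < m.+1) strip_value R j - strip_value R K - strip_value R J.+1 +
  2 * (m%:R ^+ 2 - J%:R - K%:R) + side J + side K + 2.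
Proof.
move=> n9; rewrite /alpha /remainder_term.
have nE := divn_eq m.+2 9; have := ltn_pmod m.+2 (isT : (0 < 9)%N).
(* Taking one from the quotient, positive since n >= 9, makes [m], [J] and [K] linear in [s] with
   natural coefficients. *)
move: nE; set s := (m.+2 %/ 9).-1; set r := (m.+2 %% 9)%N => nE r9.
have {}nE : m.+2 = (9 * s + (r + 9))%N by rewrite /s /r in nE *; lia.
have {s} [s {}nE] : exists s, m.+2 = (9 * s + (r + 9))%N by exists s.
move: r nE r9.
case=> [|[|[|[|[|[|[|[|[|//]]]]]]]]] nE _.
- have mE : (m = 9 * s + 7)%N by lia.
  rewrite [in LHS]nE.
  have -> : (m.+1 = 3 * (3 * s + 2) + 2)%N by lia.
  (* [KE] and [J1E] exhibit quotient and remainder by 3 for [strip_valueE]; [JE] and [K3E] serve in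
     the polynomial terms. *)
  have KE : (K = 3 * (1 * s + 0) + 2)%N by rewrite /K; lia.
  have J1E : (J.+1 = 3 * (1 * s + 1) + 0)%N by rewrite /J; lia.
  have JE : (J = 3 * s + 2)%N by lia.
  have K3E : (K = 3 * s + 2)%N by lia.
  rewrite sum_strip_valueE // J1E [in strip_value R K]KE !strip_valueE //.
  by rewrite /side /strip_poly mE JE K3E !cast_linear /=; field.
- have mE : (m = 9 * s + 8)%N by lia.
  rewrite [in LHS]nE.
  have -> : (m.+1 = 3 * (3 * s + 3) + 0)%N by lia.
  have KE : (K = 3 * (1 * s + 0) + 2)%N by rewrite /K; lia.
  have J1E : (J.+1 = 3 * (1 * s + 1) + 0)%N by rewrite /J; lia.
  have JE : (J = 3 * s + 2)%N by lia.
  have K3E : (K = 3 * s + 2)%N by lia.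
  rewrite sum_strip_valueE // J1E [in strip_value R K]KE !strip_valueE //.
  by rewrite /side /strip_poly mE JE K3E !cast_linear /=; field.
- have mE : (m = 9 * s + 9)%N by lia.
  rewrite [in LHS]nE.
  have -> : (m.+1 = 3 * (3 * s + 3) + 1)%N by lia.
  have KE : (K = 3 * (1 * s + 1) + 0)%N by rewrite /K; lia.
  have J1E : (J.+1 = 3 * (1 * s + 1) + 0)%N by rewrite /J; lia.
  have JE : (J = 3 * s + 2)%N by lia.
  have K3E : (K = 3 * s + 3)%N by lia.
  rewrite sum_strip_valueE // J1E [in strip_value R K]KE !strip_valueE //.
  by rewrite /side /strip_poly mE JE K3E !cast_linear /=; field.
- have mE : (m = 9 * s + 10)%N by lia.
  rewrite [in LHS]nE.
  have -> : (m.+1 = 3 * (3 * s + 3) + 2)%N by lia.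
  have KE : (K = 3 * (1 * s + 1) + 0)%N by rewrite /K; lia.
  have J1E : (J.+1 = 3 * (1 * s + 1) + 1)%N by rewrite /J; lia.
  have JE : (J = 3 * s + 3)%N by lia.
  have K3E : (K = 3 * s + 3)%N by lia.
  rewrite sum_strip_valueE // J1E [in strip_value R K]KE !strip_valueE //.
  by rewrite /side /strip_poly mE JE K3E !cast_linear /=; field.
- have mE : (m = 9 * s + 11)%N by lia.
  rewrite [in LHS]nE.
  have -> : (m.+1 = 3 * (3 * s + 4) + 0)%N by lia.
  have KE : (K = 3 * (1 * s + 1) + 0)%N by rewrite /K; lia.
  have J1E : (J.+1 = 3 * (1 * s + 1) + 1)%N by rewrite /J; lia.
  have JE : (J = 3 * s + 3)%N by lia.
  have K3E : (K = 3 * s + 3)%N by lia.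
  rewrite sum_strip_valueE // J1E [in strip_value R K]KE !strip_valueE //.
  by rewrite /side /strip_poly mE JE K3E !cast_linear /=; field.
- have mE : (m = 9 * s + 12)%N by lia.
  rewrite [in LHS]nE.
  have -> : (m.+1 = 3 * (3 * s + 4) + 1)%N by lia.
  have KE : (K = 3 * (1 * s + 1) + 1)%N by rewrite /K; lia.
  have J1E : (J.+1 = 3 * (1 * s + 1) + 1)%N by rewrite /J; lia.
  have JE : (J = 3 * s + 3)%N by lia.
  have K3E : (K = 3 * s + 4)%N by lia.
  rewrite sum_strip_valueE // J1E [in strip_value R K]KE !strip_valueE //.
  by rewrite /side /strip_poly mE JE K3E !cast_linear /=; field.
- have mE : (m = 9 * s + 13)%N by lia.
  rewrite [in LHS]nE.
  have -> : (m.+1 = 3 * (3 * s + 4) + 2)%N by lia.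
  have KE : (K = 3 * (1 * s + 1) + 1)%N by rewrite /K; lia.
  have J1E : (J.+1 = 3 * (1 * s + 1) + 2)%N by rewrite /J; lia.
  have JE : (J = 3 * s + 4)%N by lia.
  have K3E : (K = 3 * s + 4)%N by lia.
  rewrite sum_strip_valueE // J1E [in strip_value R K]KE !strip_valueE //.
  by rewrite /side /strip_poly mE JE K3E !cast_linear /=; field.
- have mE : (m = 9 * s + 14)%N by lia.
  rewrite [in LHS]nE.
  have -> : (m.+1 = 3 * (3 * s + 5) + 0)%N by lia.
  have KE : (K = 3 * (1 * s + 1) + 1)%N by rewrite /K; lia.
  have J1E : (J.+1 = 3 * (1 * s + 1) + 2)%N by rewrite /J; lia.
  have JE : (J = 3 * s + 4)%N by lia.
  have K3E : (K = 3 * s + 4)%N by lia.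
  rewrite sum_strip_valueE // J1E [in strip_value R K]KE !strip_valueE //.
  by rewrite /side /strip_poly mE JE K3E !cast_linear /=; field.
- have mE : (m = 9 * s + 15)%N by lia.
  rewrite [in LHS]nE.
  have -> : (m.+1 = 3 * (3 * s + 5) + 1)%N by lia.
  have KE : (K = 3 * (1 * s + 1) + 2)%N by rewrite /K; lia.
  have J1E : (J.+1 = 3 * (1 * s + 1) + 2)%N by rewrite /J; lia.
  have JE : (J = 3 * s + 4)%N by lia.
  have K3E : (K = 3 * s + 5)%N by lia.
  rewrite sum_strip_valueE // J1E [in strip_value R K]KE !strip_valueE //.
  by rewrite /side /strip_poly mE JE K3E !cast_linear /=; field.
Qed.
End Final.

Theorem mainTheorem1 (R : realType) (n : nat) :
  (9 <= n)%N -> alpha R n <= max_sum_sq R n.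
Proof.
case: n => [|[|m]] // n9.
(* With these choices, floor(n/3) - 1 and floor((n + 1)/3) - 1, the sum for the tour is exactly
   [alpha R n]. *)
pose J := (m.+2 %/ 3).-1; pose K := (m.+3 %/ 3).-1.
have J0 : (0 < J)%N by rewrite /J; lia.
have K0 : (0 < K)%N by rewrite /K; lia.
have Jm : (J.+2 <= m)%N by rewrite /J; lia.
have Km : (K.+2 <= m)%N by rewrite /K; lia.
have [L L_closed L_sum] := closed_broken_line_of_cycle
  (fun a b c e => tour_edge_meet_properly (R := R) (d := offset m J K) Jm Km)
  (tour_path J0 K0 Jm Km) (tour_uniq J0 K0 Jm Km) (size_tour J0 K0 Jm Km)
  (tour_in_grid J0 K0 Jm Km).
rewrite alphaE // -(pathlen_tour R J0 K0 Jm Km) -L_sum.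
by apply: le_bigmax_cond; apply/asboolP.
Qed.
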